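(* Let $G$ be a claw-free 4-regular 4-star colourable graph. Then $G$ is the line graph of a bipartite graph, and in particular $G$ is odd-hole-free.
   Context: Graphs are finite and simple. Claw-free means no induced $K_{1,3}$. A 4-star colouring is a proper colouring with 4 colours such that the subgraph induced by any two colour classes has every component a star. Odd-hole-free means $G$ has no induced cycle $C_{2q+3}$ for any positive integer $q$. *)

(* Defs.v *)
From mathcomp Require Import all_boot.

Set Implicit Arguments.
Unset Strict Implicit.
Unset Printing Implicit Defensive.

Record sgraph := SGraph {
  vertex :> finType;
  adj : rel vertex;
  adj_sym : symmetric adj;
  adj_irrefl : irreflexive adj }.

Definition graph_iso (G H : sgraph) : Prop :=
  exists2 phi : G -> H, bijective phi & {mono phi : x y / adj x y}.

Definition induced_in (F G : sgraph) : Prop :=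
  exists2 phi : F -> G, injective phi & {mono phi : x y / adj x y}.

Section Induced.
Variables (G : sgraph) (A : {set G}).

Definition induced_adj : rel {x : G | x \in A} :=
  [rel x y | adj (val x) (val y)].

Lemma induced_adj_sym : symmetric induced_adj.
Proof. by move=> x y; exact: adj_sym. Qed.

Lemma induced_adj_irrefl : irreflexive induced_adj.
Proof. by move=> x; exact: adj_irrefl. Qed.

Definition induced : sgraph := SGraph induced_adj_sym induced_adj_irrefl.
End Induced.

Section CompleteBipartite.
Variables m n : nat.

Definition complete_bipartite_adj : rel ('I_m + 'I_n)%type :=
  fun u v => match u, v with
             | inl _, inr _ | inr _, inl _ => true
             | _, _ => false
             end.

Lemma complete_bipartite_adj_sym : symmetric complete_bipartite_adj.
Proof. by do 2!case=> ?. Qed.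

Lemma complete_bipartite_adj_irrefl : irreflexive complete_bipartite_adj.
Proof. by case. Qed.

Definition complete_bipartite : sgraph :=
  SGraph complete_bipartite_adj_sym complete_bipartite_adj_irrefl.
End CompleteBipartite.

(* [ordS i] is the successor of [i] modulo [n]. For [n >= 3] this is the
   cycle of length [n]; the conjunct [i != j] only matters for [n = 1]. *)
Section Cycle.
Variable n : nat.

Definition cycle_adj : rel 'I_n :=
  [rel i j | (i != j) && ((j == ordS i) || (i == ordS j))].

Lemma cycle_adj_sym : symmetric cycle_adj.
Proof. by move=> i j; rewrite /cycle_adj /= eq_sym orbC. Qed.

Lemma cycle_adj_irrefl : irreflexive cycle_adj.
Proof. by move=> i; rewrite /cycle_adj /= eqxx. Qed.

Definition cycle_graph : sgraph := SGraph cycle_adj_sym cycle_adj_irrefl.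
End Cycle.

Definition edge_set (G : sgraph) : {set {set G}} :=
  [set [set p.1; p.2] | p : G * G & adj p.1 p.2].

Section LineGraph.
Variable G : sgraph.

Definition line_adj : rel {E : {set G} | E \in edge_set G} :=
  [rel E F | (E != F) && (val E :&: val F != set0)].

Lemma line_adj_sym : symmetric line_adj.
Proof. by move=> E F; rewrite /line_adj /= eq_sym setIC. Qed.

Lemma line_adj_irrefl : irreflexive line_adj.
Proof. by move=> E; rewrite /line_adj /= eqxx. Qed.

Definition line_graph : sgraph := SGraph line_adj_sym line_adj_irrefl.
End LineGraph.

Definition bipartite (G : sgraph) : Prop :=
  exists A : {set G}, forall x y : G, adj x y -> (x \in A) != (y \in A).

Definition regular (k : nat) (G : sgraph) : Prop :=
  forall x : G, #|[set y | adj x y]| = k.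

Definition claw_free (G : sgraph) : Prop :=
  ~ induced_in (complete_bipartite 1 3) G.

Definition odd_hole_free (G : sgraph) : Prop :=
  forall q : nat, 0 < q -> ~ induced_in (cycle_graph (2 * q + 3)) G.

Definition component (G : sgraph) (x : G) : {set G} :=
  [set y | connect (@adj G) x y].

(* The case [m = 0] makes a single vertex a star. *)
Definition star (G : sgraph) : Prop :=
  exists m : nat, graph_iso G (complete_bipartite 1 m).

Definition proper_colouring (k : nat) (G : sgraph) (f : G -> 'I_k) : Prop :=
  forall x y : G, adj x y -> f x != f y.

Definition bicoloured (k : nat) (G : sgraph) (f : G -> 'I_k) (i j : 'I_k) :
  sgraph := induced [set x | (f x == i) || (f x == j)].

(* Colour classes are allowed to be empty. *)
Definition star_colouring (k : nat) (G : sgraph) (f : G -> 'I_k) : Prop :=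
  proper_colouring f /\
  forall i j : 'I_k, i != j ->
    forall x : bicoloured f i j, star (induced (component x)).

Definition star_colourable (k : nat) (G : sgraph) : Prop :=
  exists f : G -> 'I_k, star_colouring f.

(* Main.v *)
(** Double counting shows that every vertex [v] sees one colour [twin v] twice
    and the two remaining foreign colours once, and that every edge [xy]
    satisfies exactly one of [f x = twin y], [f y = twin x].  Claw-freeness then
    makes every neighbourhood two disjoint edges, so that each vertex lies on
    two triangles.  A triangle is cyclically oriented by [f x = twin y], and the
    parity of its colours in this order, followed by the missing colour, differs
    between the two triangles at a vertex.  Giving each edge the parity of its
    triangle yields an edge labelling from which both claims follow: the
    triangles are the vertices of a bipartite root graph, and the labels
    alternate along any induced cycle of length at least 4. *)
Require Import Defs.
From mathcomp Require Import all_boot.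
From mathcomp Require Import zify.

Set Implicit Arguments.
Unset Strict Implicit.
Unset Printing Implicit Defensive.

(** In the manner of Krausz, this partitions the edges into cliques, at most two at each vertex; the
    label tells these two apart. *)
Definition clique_labelling (G : sgraph) (s : G -> G -> bool) : Prop :=
  (forall x y, adj x y -> s x y = s y x) /\
  (forall v u w, adj v u -> adj v w -> u != w -> adj u w = (s v u == s v w)).

(** * Bipartite root graph of a labelled graph *)

Section RootGraph.
Variables (G : sgraph) (s : G -> G -> bool).
Hypothesis s_lab : clique_labelling s.

(** Containing [v] makes all members of one clique yield the same set; without [b]-labelled edges at
    [v] it is a singleton, which still serves as an endpoint. *)
Definition label_clique (b : bool) (v : G) : {set G} :=
  [set u | (u == v) || (adj v u && (s v u == b))].

(* Pairs [(b, A)] with [A] not a [b]-clique are isolated vertices. *)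
Definition root_adj : rel (bool * {set G}) :=
  [rel p q | (p.1 != q.1) &&
    [exists v, (p.2 == label_clique p.1 v) && (q.2 == label_clique q.1 v)]].

Lemma root_adj_sym : symmetric root_adj.
Proof.
move=> p q; rewrite /root_adj /= eq_sym; congr (_ && _).
by apply: eq_existsb => v; rewrite andbC.
Qed.

Lemma root_adj_irrefl : irreflexive root_adj.
Proof. by move=> p; rewrite /root_adj /= eqxx. Qed.

Definition root_graph : sgraph := SGraph root_adj_sym root_adj_irrefl.

Lemma root_graph_bipartite : bipartite root_graph.
Proof.
exists [set p : bool * {set G} | p.1] => p q /andP[pq _].
by rewrite !inE.
Qed.

(** Edges labelled [b] form a transitive relation: two [b]-neighbours of [x] are adjacent by the
    labelling at [x], and the labelling at one of them then forces the label [b] on the new edge. *)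
Lemma label_clique_eq b v w :
  v != w -> (label_clique b v == label_clique b w) = adj v w && (s v w == b).
Proof.
case: s_lab => s_sym s_cl vw; apply/eqP/idP => [Ebvw|].
  have: w \in label_clique b v by rewrite Ebvw inE eqxx.
  by rewrite inE eq_sym (negPf vw).
have sub x y z : adj x y -> s x y = b ->
    z \in label_clique b x -> z \in label_clique b y.
  move=> xy sxy; rewrite !inE; have [->|zy] := eqVneq z y => //=.
  have yx : adj y x by rewrite adj_sym.
  case/predU1P => [->|/andP[xz /eqP sxz]]; first by rewrite yx -s_sym // sxy eqxx.
  have yz : adj y z by rewrite (s_cl x) // ?sxy ?sxz // eq_sym.
  have zx : z != x by apply: contraTneq xz => ->; rewrite adj_irrefl.
  by move: xz; rewrite yz adj_sym (s_cl y) // => /eqP ->; rewrite -s_sym // sxy /=.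
case/andP => vw_adj /eqP svw; apply/setP => z; apply/idP/idP; apply: sub => //.
  by rewrite adj_sym.
by rewrite -s_sym.
Qed.

Definition root_edge (v : G) : {set root_graph} :=
  [set (true, label_clique true v); (false, label_clique false v)].

Lemma root_edge_in v : root_edge v \in edge_set root_graph.
Proof.
apply/imsetP.
exists ((true, label_clique true v), (false, label_clique false v)) => //.
by rewrite inE /=; apply/existsP; exists v; rewrite /= !eqxx.
Qed.

Lemma root_edge_meet v w :
  (root_edge v :&: root_edge w != set0) =
  [exists b, label_clique b v == label_clique b w].
Proof.
apply/set0Pn/existsP => [[[b A]]|[b /eqP Ebvw]].
  rewrite !inE !xpair_eqE.
  by case: b => /=; rewrite ?orbF => /andP[/eqP -> E]; [exists true|exists false].
exists (b, label_clique b v); rewrite !inE !xpair_eqE.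
by case: b Ebvw => ->; rewrite !eqxx ?orbT.
Qed.

Lemma root_edge_inj : injective root_edge.
Proof.
move=> v w Evw; apply/eqP; apply: contraT => vw.
have eqb b : label_clique b v == label_clique b w.
  have: (b, label_clique b v) \in root_edge w.
    by rewrite -Evw !inE; case: b; rewrite eqxx ?orbT.
  by rewrite !inE !xpair_eqE; case: b; rewrite /= ?orbF.
(* Sharing both cliques would give the edge [vw] both labels. *)
have := eqb true; have := eqb false.
by rewrite !label_clique_eq // => /andP[_ /eqP ->]; rewrite andbF.
Qed.

Lemma line_graph_root : graph_iso G (line_graph root_graph).
Proof.
pose phi v : line_graph root_graph := Sub (root_edge v) (root_edge_in v).
have phi_inj : injective phi by move=> v w /(congr1 val) /root_edge_inj.
exists phi.
  pose P (E : line_graph root_graph) v := phi v == E.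
  have ex E : exists v, P E v.
    have /imsetP[[[b A] [b' A']] + EE] := valP E.
    rewrite inE => /andP[/= bb' /existsP[v /andP[/= /eqP EA /eqP EA']]].
    rewrite {}EA {}EA' in EE; exists v; apply/eqP/val_inj; rewrite EE /= /root_edge.
    by case: b b' bb' {EE} => [] [] // _; rewrite setUC.
  pose psi E := xchoose (ex E).
  have psiK : cancel psi phi by move=> E; apply/eqP/(xchooseP (ex E)).
  by exists psi => // v; apply: phi_inj; rewrite psiK.
move=> v w.
rewrite -[LHS]/((phi v != phi w) && (root_edge v :&: root_edge w != set0)).
rewrite root_edge_meet (inj_eq phi_inj).
have [->|vw] /= := eqVneq v w; first by rewrite adj_irrefl.
apply/existsP/idP => [[b]|vw_adj]; first by rewrite label_clique_eq // => /andP[].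
by exists (s v w); rewrite label_clique_eq // vw_adj eqxx.
Qed.

End RootGraph.

(** * Labels along an induced cycle *)

Lemma val_iter_ordS n (i : 'I_n) k : iter k (@ordS n) i = (i + k) %% n :> nat.
Proof.
elim: k => [|k IHk] /=; first by rewrite addn0 modn_small.
by rewrite IHk -addn1 modnDml addn1 addnS.
Qed.

Lemma iter_ordS_neq n (i : 'I_n) k : 0 < k < n -> i != iter k (@ordS n) i.
Proof.
move=> k_bnd; rewrite -val_eqE /= val_iter_ordS -{1}(modn_small (ltn_ord i)).
rewrite -{1}[nat_of_ord i]addn0 eqn_modDl mod0n modn_small; lia.
Qed.

(** Adjacency would make a shift by 1 or by 3 trivial modulo [n]. *)
Lemma cycle_not_adj2 n (i : 'I_n) :
  3 < n -> (i != ordS (ordS i)) && ~~ cycle_adj i (ordS (ordS i)).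
Proof.
move=> n_gt3.
have /= neq1 := @iter_ordS_neq n i 1 ltac:(lia).
have /= neq2 := @iter_ordS_neq n i 2 ltac:(lia).
have /= neq3 := @iter_ordS_neq n i 3 ltac:(lia).
rewrite /cycle_adj /= neq2 (inj_eq (@ordS_inj n)) eq_sym (negPf neq1).
exact: neq3.
Qed.

Lemma clique_labelling_odd_hole_free (G : sgraph) (s : G -> G -> bool) :
  clique_labelling s -> odd_hole_free G.
Proof.
move=> [s_sym s_cl] q q_gt0 [phi phi_inj phi_adj].
set n := 2 * q + 3 in phi phi_inj phi_adj.
have n_gt3 : 3 < n by rewrite /n; lia.
have adjS (i : 'I_n) : adj (phi i) (phi (ordS i)).
  rewrite phi_adj /= /cycle_adj /= eqxx andbT.
  by apply: (iter_ordS_neq i (k := 1)); lia.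
pose t (i : 'I_n) := s (phi i) (phi (ordS i)).
have tS i : t (ordS i) = ~~ t i.
  have /andP[neq nadj] := cycle_not_adj2 i n_gt3.
  have Sadj : adj (phi (ordS i)) (phi i) by rewrite adj_sym.
  (* The labelling is applied at the middle vertex, whose two cycle neighbours are distinct and
     non-adjacent. *)
  have := s_cl _ _ (phi (ordS (ordS i))) Sadj (adjS _).
  rewrite (inj_eq phi_inj) neq phi_adj [LHS](negPf nadj) (s_sym _ _ Sadj).
  by rewrite -/(t i) -/(t (ordS i)) => /(_ isT); do 2!case: (t _).
have n_gt0 : 0 < n by lia.
pose i0 := Ordinal n_gt0.
have t_iter k : t (iter k (@ordS n) i0) = t i0 (+) odd k.
  by elim: k => [|k IHk] /=; rewrite ?addbF // tS IHk addbN.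
have i0_iter : iter n (@ordS n) i0 = i0.
  by apply: val_inj; exact: etrans (val_iter_ordS i0 n) (modnn n).
(* A full turn returns to [i0] after an odd number of flips. *)
have := t_iter n; rewrite i0_iter /n oddD mul2n odd_double.
by case: (t i0).
Qed.

(** * Colour parity and claws *)

(* Up to a global sign, the parity of [i, j, k, l] where [l] is the colour
   missing from [i, j, k]. *)
Definition colour_parity (i j k : 'I_4) : bool :=
  (j < i) (+) (k < i) (+) (k < j) (+) odd (i + j + k).

(** A rotation of three entries is even and keeps the missing colour, which contributes
    [odd (i + j + k)]. *)
Lemma colour_parity_rot i j k :
  i != j -> j != k -> k != i -> colour_parity i j k = colour_parity j k i.
Proof.
by move: i j k => [[|[|[|[|i]]]] // ?] [[|[|[|[|j]]]] // ?] [[|[|[|[|k]]]] // ?].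
Qed.

(** If [k] and [l] differ, each is the colour missing from the other triple, so passing between the
    triples is a transposition. *)
Lemma colour_parity_eq i j k l : i != j ->
  k != i -> k != j -> l != i -> l != j ->
  (colour_parity i j k == colour_parity i j l) = (k == l).
Proof.
by move: i j k l => [[|[|[|[|i]]]] // ?] [[|[|[|[|j]]]] // ?]
  [[|[|[|[|k]]]] // ?] [[|[|[|[|l]]]] // ?].
Qed.

Lemma claw_freeP (G : sgraph) (v a b c : G) : claw_free G ->
  adj v a -> adj v b -> adj v c -> a != b -> a != c -> b != c ->
  [|| adj a b, adj a c | adj b c].
Proof.
move=> cf va vb vc ab ac bc; apply: contra_notT cf.
rewrite !negb_or => /and3P[nab nac nbc].
pose leaf := tnth [tuple a; b; c].
pose phi (u : complete_bipartite 1 3) : G :=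
  match u with inl _ => v | inr i => leaf i end.
have v_leaf i : adj v (leaf i).
  by case: i => [[|[|[|i]]] // ?]; rewrite /leaf (tnth_nth a).
exists phi; last first.
  case=> [i|i] [j|j] /=; rewrite ?adj_irrefl ?v_leaf //.
    by rewrite adj_sym v_leaf.
  move: i j => [[|[|[|i]]] // ?] [[|[|[|j]]] // ?];
  by rewrite /leaf !(tnth_nth a) /= ?adj_irrefl //
             1?(negPf nab, negPf nac, negPf nbc) // adj_sym; apply: negPf.
case=> [i|i] [j|j] /=; rewrite ?ord1 // => E.
- by have := v_leaf j; rewrite -E adj_irrefl.
- by have := v_leaf i; rewrite E adj_irrefl.
congr inr; apply/eqP; move/eqP: E; apply: contraTT.
move: i j => [[|[|[|i]]] // ?] [[|[|[|j]]] // ?];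
by rewrite /leaf !(tnth_nth a) //= => _; rewrite eq_sym.
Qed.

(** * Colour multiplicities in a star colouring *)

Section StarColouring.
Variables (G : sgraph) (f : G -> 'I_4).

Definition colour_deg (v : G) (i : 'I_4) : nat :=
  #|[set u | adj v u && (f u == i)]|.

Lemma colour_deg_gt1 v u : 1 < colour_deg v (f u) -> adj v u ->
  exists2 w, w != u & adj v w && (f w == f u).
Proof.
move=> deg_gt1 vu; move: deg_gt1; rewrite /colour_deg (cardsD1 u).
rewrite inE vu eqxx ltnS card_gt0 => /set0Pn[w].
by rewrite !inE => /andP[wu H]; exists w.
Qed.

Hypothesis f_star : star_colouring f.

Lemma f_proper x y : adj x y -> f x != f y.
Proof. exact: f_star.1. Qed.

(** Otherwise a bicoloured walk [x'], [x], [y], [y'] lies in one component. In a star [x] or [y] is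
    the centre; if it is [x], the neighbour [y'] of the leaf [y] must be [x], and symmetrically for
    [y]. *)
Lemma star_no_path4 x y : adj x y ->
  1 < colour_deg x (f y) -> 1 < colour_deg y (f x) -> False.
Proof.
move=> xy /colour_deg_gt1 /(_ xy) [x' x'y /andP[xx' /eqP fx']].
have yx : adj y x by rewrite adj_sym.
move=> /colour_deg_gt1 /(_ yx) [y' y'x /andP[yy' /eqP fy']].
pose B := bicoloured f (f x) (f y).
have inB z : (f z == f x) || (f z == f y) ->
  z \in [set z | (f z == f x) || (f z == f y)] by rewrite inE.
have xB := inB x; rewrite eqxx in xB.
have yB := inB y; rewrite eqxx orbT in yB.
have x'B := inB x'; rewrite fx' eqxx orbT in x'B.
have y'B := inB y'; rewrite fy' eqxx in y'B.
pose X : B := Sub x (xB isT); pose Y : B := Sub y (yB isT).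
pose X' : B := Sub x' (x'B isT); pose Y' : B := Sub y' (y'B isT).
have XY : connect (@adj B) X Y by apply: connect1.
have XX' : connect (@adj B) X X' by apply: connect1.
have XY' : connect (@adj B) X Y'.
  by apply: connect_trans XY _; apply: connect1.
have [m [phi /bij_inj phi_inj phi_adj]] := f_star.2 _ _ (f_proper xy) X.
have inC (Z : B) : connect (@adj B) X Z -> Z \in component X by rewrite inE.
pose CX : induced (component X) := Sub X (inC X (connect0 _ _)).
pose CY : induced (component X) := Sub Y (inC Y XY).
pose CX' : induced (component X) := Sub X' (inC X' XX').
pose CY' : induced (component X) := Sub Y' (inC Y' XY').
have exy : adj (phi CX) (phi CY) by rewrite phi_adj.
have exx' : adj (phi CX) (phi CX') by rewrite phi_adj.
have eyy' : adj (phi CY) (phi CY') by rewrite phi_adj.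
have nx'y : phi CX' != phi CY.
  by rewrite (inj_eq phi_inj) -!val_eqE.
have ny'x : phi CY' != phi CX.
  by rewrite (inj_eq phi_inj) -!val_eqE.
move: exy exx' eyy' nx'y ny'x.
by case: (phi CX) (phi CX') (phi CY) (phi CY') => [i|i] [j|j] [k|k] [l|l] //=;
   rewrite ?(ord1 i) ?(ord1 j) ?(ord1 k) ?(ord1 l) eqxx.
Qed.

(** * Double counting and twin colours *)

Hypothesis G_regular : regular 4 G.

Lemma sum_adj_colour (P : pred 'I_4) v :
  \sum_(u | adj v u) P (f u) = \sum_(i | P i) colour_deg v i.
Proof.
rewrite (partition_big f xpredT) //= [RHS]big_mkcond; apply: eq_bigr => i _.
rewrite (eq_bigr (fun=> nat_of_bool (P i))); last by move=> u /andP[_ /eqP ->].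
rewrite sum_nat_const /colour_deg cardsE.
by case: (P i); rewrite ?muln0 ?muln1.
Qed.

Lemma sum_colour_deg v : \sum_i colour_deg v i = 4.
Proof. by rewrite -(sum_adj_colour predT) sum1_card -(G_regular v) cardsE. Qed.

Lemma colour_deg_self v : colour_deg v (f v) = 0.
Proof.
apply: eq_card0 => u; rewrite !inE; apply/negP => /andP[/f_proper].
by rewrite eq_sym => /negPf ->.
Qed.

(** The partitions 4, 3+1, 2+2, 2+1+1 have parts above 1 totalling 4, 3, 4, 2. The equality case is
    kept because double counting will force it. *)
Lemma four_into_three (d : 'I_4 -> nat) j : d j = 0 -> \sum_i d i = 4 ->
  (2 <= \sum_(i | 1 < d i) d i ?= iff
    [exists c, (c != j) &&
      [forall i, d i == if i == j then 0 else if i == c then 2 else 1]]).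
Proof.
move=> dj0 sum_d.
have ex : exists c, 1 < d c.
  apply/existsP; apply: contraPT sum_d; rewrite negb_exists => /forallP d_le1.
  rewrite (bigD1 j) //= dj0; apply/eqP; rewrite neq_ltn; apply/orP; left.
  apply: (@leq_ltn_trans (\sum_(i | i != j) 1)).
    by apply: leq_sum => i _; rewrite leqNgt.
  by rewrite sum1_card cardC1 card_ord.
have [c dc] := ex.
have cj : c != j by apply: contraTneq dc => ->; rewrite dj0.
have sum_jc : d c + \sum_(i | (i != j) && (i != c)) d i = 4.
  by rewrite -[RHS]sum_d [RHS](bigD1 j) //= dj0 add0n [RHS](bigD1 c).
have sum_gt1 : \sum_(i | 1 < d i) d i =
    d c + \sum_(i | (1 < d i) && (i != c)) d i by rewrite (bigD1 c).
rewrite sum_gt1; split; first by lia.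
apply/idP/existsP => [sum2|[c' /andP[c'j /forallP d_eq]]].
  have dc2 : d c = 2 by lia.
  have d_le1 i : i != c -> d i <= 1.
    move=> ic; rewrite leqNgt; apply/negP => di.
    by move: sum2; rewrite (bigD1 i) ?di //=; lia.
  exists c; rewrite cj; apply/forallP => i.
  have [->|ij] := eqVneq i j; first by rewrite dj0.
  have [->|ic] := eqVneq i c; first by rewrite dc2.
  rewrite eqn_leq d_le1 //= lt0n; apply/eqP => di0.
  (* With [d i = 0], a single colour of value at most 1 would have to supply the remaining 2. *)
  have : \sum_(k | (k != j) && (k != c)) d k <=
         \sum_(k | (k != j) && (k != c)) (k != i).
    apply: leq_sum => k /andP[_ /d_le1]; have [->|] := eqVneq k i => //.
    by rewrite di0.
  have -> : \sum_(k | (k != j) && (k != c)) d k = 2.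
    by apply/eqP; rewrite -(eqn_add2l (d c)) sum_jc dc2.
  rewrite -big_mkcondr /= sum1_card.
  have -> : #|[pred k | (k != j) && (k != c) && (k != i)]| =
            #|~: [set j; c; i]|.
    by apply: eq_card => k; rewrite !inE !negb_or.
  have := cardsC [set j; c; i]; rewrite card_ord.
  have -> : #|[set j; c; i]| = 3.
    by rewrite setUC cardsU1 cards2 !inE (negPf ij) (negPf ic) eq_sym cj.
  lia.
have dE i := eqP (d_eq i).
have c_eq : c = c'.
  by move: dc; rewrite dE (negPf cj); case: eqP.
rewrite {1}c_eq dE (negPf c'j) eqxx big1 // => i /andP[].
by rewrite dE; case: ifP => // _; rewrite -c_eq; case: ifP.
Qed.

(** Let [w x y] be 1 when the colour of [y] repeats around [x]. Each vertex emits at least 2 and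
    each edge carries at most 1, so twice the total of [w] lies between [4 * #|G|] and the number of
    ordered adjacent pairs, also [4 * #|G|]; all bounds are tight. *)
Lemma star_degrees :
  (forall v, \sum_(u | adj v u) (1 < colour_deg v (f u)) = 2) /\
  (forall x y, adj x y ->
     (1 < colour_deg x (f y)) + (1 < colour_deg y (f x)) = 1).
Proof.
pose w x y : nat := 1 < colour_deg x (f y).
have out_ge2 v : 2 <= \sum_(u | adj v u) w v u.
  rewrite /w (sum_adj_colour (fun i => 1 < colour_deg v i)).
  exact: four_into_three (colour_deg_self v) (sum_colour_deg v).
have edge_le1 x y : adj x y -> w x y + w y x <= 1.
  move=> xy; have := star_no_path4 xy; rewrite /w.
  by do 2!case: (1 < _) => //; move=> /(_ isT isT).
have sum_w : \sum_x \sum_(y | adj x y) (w x y + w y x) =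
             2 * \sum_x \sum_(y | adj x y) w x y.
  under eq_bigr do rewrite big_split.
  rewrite big_split mul2n -addnn; congr (_ + _).
  rewrite (exchange_big_dep predT) //=.
  by apply: eq_bigr => x _ /=; apply: eq_bigl => y; rewrite adj_sym.
have sum_1 : \sum_(x : G) \sum_(y | adj x y) 1 = 4 * #|G|.
  rewrite (eq_bigr (fun=> 4)) ?sum_nat_const 1?mulnC // => x _.
  by rewrite sum1_card -(G_regular x) cardsE.
have upper : \sum_x \sum_(y | adj x y) (w x y + w y x) <=
             \sum_(x : G) \sum_(y | adj x y) 1.
  by apply: leq_sum => x _; apply: leq_sum => y; apply: edge_le1.
have lower : \sum_(x : G) 2 <= \sum_x \sum_(y | adj x y) w x y.
  by apply: leq_sum => x _.
have lowerE : \sum_(x : G) 2 = 2 * #|G| by rewrite sum_nat_const mulnC.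
split=> [v|x y xy]; apply/eqP.
  have : \sum_(x : G) 2 == \sum_x \sum_(y | adj x y) w x y by lia.
  rewrite (leqif_sum (fun x _ => leqif_eq (out_ge2 x))) => /forallP /(_ v).
  by rewrite /= eq_sym.
have : \sum_x \sum_(y | adj x y) (w x y + w y x) ==
       \sum_(x : G) \sum_(y | adj x y) 1 by lia.
rewrite (leqif_sum (fun x _ =>
  leqif_sum (fun y xy => leqif_eq (edge_le1 x y xy)))).
by move=> /forallP /(_ x) /= /forall_inP /(_ y xy).
Qed.

Definition is_twin (v : G) (c : 'I_4) : bool :=
  (c != f v) && [forall i, colour_deg v i ==
    if i == f v then 0 else if i == c then 2 else 1].

Lemma ex_twin v : exists c, is_twin v c.
Proof.
have deg := four_into_three (colour_deg_self v) (sum_colour_deg v).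
apply/existsP; rewrite -deg -(sum_adj_colour (fun i => 1 < colour_deg v i)).
by rewrite star_degrees.1.
Qed.

Definition twin v : 'I_4 := xchoose (ex_twin v).

Lemma twin_neq v : twin v != f v.
Proof. by have /andP[] := xchooseP (ex_twin v). Qed.

Lemma colour_degE v i :
  colour_deg v i = if i == f v then 0 else if i == twin v then 2 else 1.
Proof. by have /andP[_ /forallP /(_ i) /eqP] := xchooseP (ex_twin v). Qed.

Lemma twin_edge x y : adj x y -> (f x == twin y) = (f y != twin x).
Proof.
move=> xy; have := star_degrees.2 x y xy.
rewrite !colour_degE (negPf (f_proper xy)) eq_sym (negPf (f_proper xy)).
by do 2!case: (_ == _).
Qed.

Lemma same_colour_twin v u w :
  adj v u -> adj v w -> u != w -> f u = f w -> f u = twin v.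
Proof.
move=> vu vw uw fuw; have := colour_degE v (f u).
rewrite eq_sym (negPf (f_proper vu)); case: eqP => // _ deg1.
have : [set u; w] \subset [set z | adj v z && (f z == f u)].
  by apply/subsetP => z; rewrite !inE => /orP[]/eqP ->; rewrite ?vu ?vw ?fuw eqxx.
by move=> /subset_leq_card; rewrite -/(colour_deg _ _) deg1 cards2 uw.
Qed.

Lemma ex_neighbour v i : i != f v -> exists2 u, adj v u & f u = i.
Proof.
move=> iv; have : 0 < colour_deg v i.
  by rewrite colour_degE (negPf iv); case: eqP.
by rewrite card_gt0 => /set0Pn[u]; rewrite inE => /andP[vu /eqP]; exists u.
Qed.

Lemma ex_twin_mate v u : adj v u -> f u = twin v ->
  exists2 u', u' != u & adj v u' /\ f u' = twin v.
Proof.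
move=> vu fu; have [|w wu /andP[vw /eqP fw]] := @colour_deg_gt1 v u _ vu.
  by rewrite colour_degE fu (negPf (twin_neq v)) eqxx.
by exists w; rewrite // fw.
Qed.

(** The triangle is cyclically oriented: [f a = twin v] and [f v = twin b], while [f a = twin b]
    would give [a] and [v] the same colour. *)
Lemma adj_twin v a b : adj v a -> f a = twin v -> adj v b -> f b != twin v ->
  adj a b -> twin a = f b.
Proof.
move=> va fa vb fb ab.
have fv : f v = twin b by apply/eqP; rewrite twin_edge.
have := twin_edge ab; rewrite -fv eq_sym (negPf (f_proper va)).
by move/esym/negbFE/eqP.
Qed.

Lemma not_adj_same_colour u w : f u = f w -> adj u w = false.
Proof. by move=> fuw; apply/negP => /f_proper; rewrite fuw eqxx. Qed.

(** * Neighbourhoods in the claw-free case *)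

Hypothesis G_claw_free : claw_free G.

(** If the twins agreed, a neighbour [c] of [v] coloured outside [f v], [twin v], [twin a] would
    form a claw with [a] and [a']. *)
Lemma twin_mates_neq v a a' : adj v a -> adj v a' -> a != a' ->
  f a = twin v -> f a' = twin v -> twin a != twin a'.
Proof.
move=> va va' aa' fa fa'; apply/eqP => taa'.
have /set0Pn[k] : ~: [set f v; twin v; twin a] != set0.
  rewrite -card_gt0 cardsCs setCK card_ord subn_gt0.
  by rewrite setUC cardsU1 cards2; do 2!case: (~~ _).
rewrite !inE !negb_or -andbA => /and3P[kv ktv kta].
have [c vc fc] := ex_neighbour kv.
have fctv : f c != twin v by rewrite fc.
have nadj x : adj v x -> f x = twin v -> twin x = twin a -> ~~ adj x c.
  move=> vx fx tx; apply/negP => /(adj_twin vx fx vc fctv).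
  by rewrite tx fc => /eqP; rewrite eq_sym (negPf kta).
have neq x : f x = twin v -> x != c.
  by move=> fx; apply: contraNneq fctv => <-; apply/eqP.
have := claw_freeP G_claw_free va va' vc aa' (neq _ fa) (neq _ fa').
by rewrite not_adj_same_colour ?fa ?fa' // (negPf (nadj _ _ _ _)) // (negPf (nadj _ _ _ _)).
Qed.

Lemma adj_twinE v a b : adj v a -> f a = twin v -> adj v b -> f b != twin v ->
  adj a b = (twin a == f b).
Proof.
move=> va fa vb fb; apply/idP/eqP => [|ta]; first exact: adj_twin va fa vb fb.
have [a' a'a [va' fa']] := ex_twin_mate va fa.
have aa' : a != a' by rewrite eq_sym.
have neq x : f x = twin v -> x != b.
  by move=> fx; apply: contraNneq fb => <-; apply/eqP.
(* If [a] and [b] were not adjacent, the mate [a'] would be adjacent to [b] and so have the same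
   twin as [a]. *)
have := claw_freeP G_claw_free va va' vb aa' (neq _ fa) (neq _ fa').
rewrite not_adj_same_colour ?fa ?fa' //= => /orP[//|a'b].
have ta' := adj_twin va' fa' vb fb a'b.
by have := twin_mates_neq va va' aa' fa fa'; rewrite ta ta' eqxx.
Qed.

(** Both [b] and [c] have twin [f v], so an edge between them would give one of them the colour of
    [v]. *)
Lemma not_adj_out v b c : adj v b -> adj v c -> b != c ->
  f b != twin v -> f c != twin v -> adj b c = false /\ f b != f c.
Proof.
move=> vb vc bc fb fc.
have tb : f v = twin b by apply/eqP; rewrite twin_edge.
have tc : f v = twin c by apply/eqP; rewrite twin_edge.
split; last by apply: contra_neq fb => /(same_colour_twin vb vc bc).
apply/negP => /twin_edge; rewrite -tb -tc eq_sym (negPf (f_proper vb)).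
by rewrite eq_sym (negPf (f_proper vc)).
Qed.

(* Following its cyclic orientation, the triangle through the edge [vu] has
   colours [twin v, f v, third_colour v u]. *)
Definition third_colour v u : 'I_4 := if f u == twin v then twin u else f u.

Definition edge_sign v u : bool :=
  colour_parity (twin v) (f v) (third_colour v u).

(** If [f y = twin x], the triples read from [x] and [y] are [f y, f x, twin y] and
    [twin y, f y, f x], equal up to rotation. *)
Lemma edge_sign_sym x y : adj x y -> edge_sign x y = edge_sign y x.
Proof.
wlog fy : x y / f y = twin x => [sym xy|xy].
  have yx : adj y x by rewrite adj_sym.
  have [/eqP fy|] := boolP (f y == twin x); first exact: sym.
  by rewrite -twin_edge // => /eqP fx; rewrite -sym.
have fx : f x != twin y.
  by rewrite twin_edge // fy eqxx.
rewrite /edge_sign /third_colour fy eqxx (negPf fx) -fy.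
rewrite -colour_parity_rot //; first exact: twin_neq.
  by rewrite eq_sym f_proper.
Qed.

Lemma third_colour_neq v u : adj v u ->
  third_colour v u != twin v /\ third_colour v u != f v.
Proof.
move=> vu; rewrite /third_colour; case: (f u =P _) => [fu|/eqP fu].
  rewrite -fu twin_neq; split=> //.
  by rewrite eq_sym twin_edge // fu eqxx.
by split; rewrite // eq_sym f_proper.
Qed.

Lemma edge_sign_labelling : clique_labelling edge_sign.
Proof.
split=> [|v u w vu vw uw]; first exact: edge_sign_sym.
have [tu fu] := third_colour_neq vu; have [tw fw] := third_colour_neq vw.
(* The first two colours depend on [v] alone, so signs agree exactly when third colours do. *)
rewrite /edge_sign colour_parity_eq ?twin_neq // /third_colour.
case: (f u =P _) => [cu|/eqP cu]; case: (f w =P _) => [cw|/eqP cw].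
- rewrite not_adj_same_colour ?cu ?cw //.
  by apply/esym/negbTE; apply: twin_mates_neq uw cu cw.
- exact: adj_twinE cu vw cw.
- by rewrite adj_sym (adj_twinE vw cw vu cu) eq_sym.
by have [-> /negPf ->] := not_adj_out vu vw uw cu cw.
Qed.

End StarColouring.

Theorem theorem15 (G : sgraph) (G_claw_free : claw_free G)
    (G_regular : regular 4 G) (G_star : star_colourable 4 G) :
  (exists2 H : sgraph, bipartite H & graph_iso G (line_graph H)) /\
  odd_hole_free G.
Proof.
have [f f_star] := G_star.
have s_lab := edge_sign_labelling f_star G_regular G_claw_free.
split; last exact: clique_labelling_odd_hole_free s_lab.
exact: ex_intro2 (root_graph_bipartite _) (line_graph_root s_lab).
Qed.
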